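(* Let $u\colon R\to U$ be an epimorphism of associative rings such that $\operatorname{Tor}^R_1(U,U)=0$ and the projective dimension of the left $R$-module $U$ does not exceed $1$. Then the associative ring homomorphism $$\operatorname{Hom}_{\mathsf D^{\mathsf b}(R\text{-mod})}(K^\bullet,K^\bullet)\longrightarrow\operatorname{Hom}_R(U/R,U/R)$$ produced by applying the degree-zero cohomology functor $H^0\colon\mathsf D^{\mathsf b}(R\text{-mod})\to R\text{-mod}$ to the complex $K^\bullet\in\mathsf D^{\mathsf b}(R\text{-mod})$ is surjective. In particular, if the ring $R$ is commutative, then so is the ring $\operatorname{Hom}_R(U/R,U/R)$.
   Context: Rings are associative and unital. A ring homomorphism $u\colon R\to U$ is a ring epimorphism iff the multiplication map $U\otimes_R U\to U$ is an isomorphism; it is not assumed injective. $R\text{-mod}$ is the category of left $R$-modules and $\mathsf D^{\mathsf b}(R\text{-mod})$ its bounded derived category. $K^\bullet$ denotes the two-term complex of left $R$-modules $R\xrightarrow{u}U$ with $R$ in cohomological degree $-1$ and $U$ in cohomological degree $0$. $U/R=H^0(K^\bullet)$ denotes the cokernel of $u$, viewed as a left $R$-module; the ring structures are given by composition of endomorphisms. *)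

(* Defs.v *)
From HB Require Import structures.
From mathcomp Require Import all_boot all_algebra.
From mathcomp Require Import boolp.

Set Implicit Arguments.
Unset Strict Implicit.
Unset Printing Implicit Defensive.

Import GRing.Theory.
Local Open Scope ring_scope.
Local Open Scope quotient_scope.

(* Rings are [pzRingType]s (the zero ring is allowed), left R-modules are
   [lmodType R]s and right R-modules are [lmodType R^c]s. *)

Lemma linear_ext (R : pzRingType) (V W : lmodType R) (f g : {linear V -> W}) :
  f =1 g -> f = g.
Proof.
move: f g => [f cf] [g cg] /= fg; have efg : f = g by apply/funext.
move: cg; rewrite -efg => -[[cg1] [cg2]]; move: cf => -[[cf1] [cf2]].
by rewrite (Prop_irrelevance cf1 cg1) (Prop_irrelevance cf2 cg2).
Qed.

Lemma inj_surj_bij (A B : Type) (f : A -> B) :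
  injective f -> (forall y, exists x, f x = y) -> bijective f.
Proof.
move=> inj_f /choice[g gK]; exists g => // x.
by apply: inj_f; rewrite gK.
Qed.

Section LinearInverse.
Variables (R : pzRingType) (V W : lmodType R) (f : {linear V -> W}).
Hypothesis bij_f : bijective f.

Definition lin_inv (y : W) : V := sval (cid (let: Bijective g _ gK := bij_f in
  ex_intro (fun x => f x = y) (g y) (gK y))).

Lemma lin_invK : cancel lin_inv f.
Proof. by move=> y; rewrite /lin_inv; case: cid. Qed.

Lemma lin_inv_linear : linear lin_inv.
Proof.
by move=> a x y; apply: (bij_inj bij_f); rewrite linearP !lin_invK.
Qed.

HB.instance Definition _ := GRing.isLinear.Build R W V _ lin_inv lin_inv_linear.

Lemma lin_invKV : cancel f lin_inv.
Proof. by move=> x; apply: (bij_inj bij_f); rewrite lin_invK. Qed.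

End LinearInverse.

Section Endo.
Variables (R : pzRingType) (V : lmodType R).

Definition endo : Type := {linear V -> V}.

HB.instance Definition _ := gen_eqMixin endo.
HB.instance Definition _ := gen_choiceMixin endo.

Definition endo_fun (f : endo) : V -> V := f.
Coercion endo_fun : endo >-> Funclass.

Definition endo_zero : endo := (\0 : {linear V -> V}).
Definition endo_opp (f : endo) : endo :=
  (\- (f : {linear V -> V}) : {linear V -> V}).
Definition endo_add (f g : endo) : endo :=
  ((f : {linear V -> V}) \+ (g : {linear V -> V}) : {linear V -> V}).
Definition endo_one : endo := (idfun : {linear V -> V}).
Definition endo_mul (f g : endo) : endo :=
  ((f : {linear V -> V}) \o (g : {linear V -> V}) : {linear V -> V}).

Lemma endo_addA : associative endo_add.
Proof. by move=> f g h; apply: linear_ext => x /=; rewrite addrA. Qed.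
Lemma endo_addC : commutative endo_add.
Proof. by move=> f g; apply: linear_ext => x /=; rewrite addrC. Qed.
Lemma endo_add0 : left_id endo_zero endo_add.
Proof. by move=> f; apply: linear_ext => x /=; rewrite add0r. Qed.
Lemma endo_addN : left_inverse endo_zero endo_opp endo_add.
Proof. by move=> f; apply: linear_ext => x /=; rewrite addNr. Qed.

HB.instance Definition _ :=
  GRing.isZmodule.Build endo endo_addA endo_addC endo_add0 endo_addN.

Lemma endo_mulA : associative endo_mul.
Proof. by move=> f g h; apply: linear_ext. Qed.
Lemma endo_mul1 : left_id endo_one endo_mul.
Proof. by move=> f; apply: linear_ext. Qed.
Lemma endo_mulr1 : right_id endo_one endo_mul.
Proof. by move=> f; apply: linear_ext. Qed.
Lemma endo_mulDl : left_distributive endo_mul endo_add.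
Proof. by move=> f g h; apply: linear_ext. Qed.
Lemma endo_mulDr : right_distributive endo_mul endo_add.
Proof. by move=> f g h; apply: linear_ext => x /=; rewrite linearD. Qed.

HB.instance Definition _ := GRing.Zmodule_isPzRing.Build endo
  endo_mulA endo_mul1 endo_mulr1 endo_mulDl endo_mulDr.

Lemma endo_addE (f g : endo) x : (f + g) x = f x + g x. Proof. by []. Qed.
Lemma endo_mulE (f g : endo) x : (f * g) x = f (g x). Proof. by []. Qed.
Lemma endo_oneE x : (1 : endo) x = x. Proof. by []. Qed.

End Endo.

Section RestrictionOfScalars.
Variables (R U : pzRingType) (u : {rmorphism R -> U}).

Definition lres of {rmorphism R -> U} : Type := U.
Local Notation lU := (lres u).
HB.instance Definition _ := GRing.Zmodule.on lU.
Definition lres_scale (a : R) (x : lU) : lU := u a * (x : U).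
Lemma lres_scaleA a b x : lres_scale a (lres_scale b x) = lres_scale (a * b) x.
Proof. by rewrite /lres_scale rmorphM mulrA. Qed.
Lemma lres_scale1 : left_id 1 lres_scale.
Proof. by move=> x; rewrite /lres_scale rmorph1 mul1r. Qed.
Lemma lres_scaleDr : right_distributive lres_scale +%R.
Proof. by move=> a x y; rewrite /lres_scale mulrDr. Qed.
Lemma lres_scaleDl x : {morph lres_scale^~ x : a b / a + b}.
Proof. by move=> a b; rewrite /lres_scale rmorphD mulrDl. Qed.
HB.instance Definition _ := GRing.Zmodule_isLmodule.Build R lU
  lres_scaleA lres_scale1 lres_scaleDr lres_scaleDl.

Definition rres of {rmorphism R -> U} : Type := U.
Local Notation rU := (rres u).
HB.instance Definition _ := GRing.Zmodule.on rU.
Definition rres_scale (a : R^c) (x : rU) : rU := (x : U) * u a.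
Lemma rres_scaleA a b x : rres_scale a (rres_scale b x) = rres_scale (a * b) x.
Proof. by rewrite /rres_scale -mulrA -rmorphM. Qed.
Lemma rres_scale1 : left_id 1 rres_scale.
Proof. by move=> x; rewrite /rres_scale rmorph1 mulr1. Qed.
Lemma rres_scaleDr : right_distributive rres_scale +%R.
Proof. by move=> a x y; rewrite /rres_scale mulrDl. Qed.
Lemma rres_scaleDl x : {morph rres_scale^~ x : a b / a + b}.
Proof. by move=> a b; rewrite /rres_scale (rmorphD u a b) mulrDr. Qed.
HB.instance Definition _ := GRing.Zmodule_isLmodule.Build R^c rU
  rres_scaleA rres_scale1 rres_scaleDr rres_scaleDl.

Definition lres_unit (a : R^o) : lU := u a.
Lemma lres_unit_linear : linear lres_unit.
Proof. by move=> a x y; rewrite /lres_unit rmorphD rmorphM. Qed.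
HB.instance Definition _ :=
  GRing.isLinear.Build R R^o lU _ lres_unit lres_unit_linear.

End RestrictionOfScalars.

Section Tensor.
Variables (R : pzRingType) (M : lmodType R^c) (N : lmodType R).
Implicit Types (s t : seq (M * N)) (m : M) (n : N).

(* A list stands for the formal sum of the pure tensors it contains.  The
   quotient of the free commutative monoid on M * N by the relations below is
   already a group, with - (m ⊗ n) = (- m) ⊗ n. *)
Inductive tens_rel : seq (M * N) -> seq (M * N) -> Prop :=
| tens_refl s : tens_rel s s
| tens_sym s t : tens_rel s t -> tens_rel t s
| tens_trans s t r : tens_rel s t -> tens_rel t r -> tens_rel s r
| tens_cat s s' t t' :
    tens_rel s s' -> tens_rel t t' -> tens_rel (s ++ t) (s' ++ t')
| tens_comm s t : tens_rel (s ++ t) (t ++ s)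
| tens_zero n : tens_rel [:: (0, n)] [::]
| tens_addl m m' n : tens_rel [:: (m + m', n)] [:: (m, n); (m', n)]
| tens_addr m n n' : tens_rel [:: (m, n + n')] [:: (m, n); (m, n')]
| tens_bal (a : R) m n : tens_rel [:: ((a : R^c) *: m, n)] [:: (m, a *: n)].

Definition tens_eq : rel (seq (M * N)) := fun s t => `[< tens_rel s t >].

Lemma tens_eq_equiv : equiv_class_of tens_eq.
Proof.
split.
- by move=> s; apply/asboolP/tens_refl.
- by move=> s t; apply/asboolP/asboolP; apply: tens_sym.
- by move=> t s r /asboolP st /asboolP tr; apply/asboolP/(tens_trans st tr).
Qed.

Canonical tens_equiv := EquivRelPack tens_eq_equiv.
Canonical tens_encModRel := defaultEncModRel tens_eq.

Definition tensor : Type := {eq_quot tens_eq}.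
HB.instance Definition _ := Choice.on tensor.
HB.instance Definition _ := EqQuotient.on tensor.

Definition tens_pi s : tensor := \pi_tensor s.

Lemma tens_piP s t : tens_pi s = tens_pi t <-> tens_rel s t.
Proof.
split; first by move=> /eqquotP /asboolP.
by move=> st; apply/eqquotP/asboolP.
Qed.

Lemma tens_reprK (x : tensor) : tens_pi (repr x) = x.
Proof. exact: reprK. Qed.

Lemma tens_repr s : tens_rel (repr (tens_pi s)) s.
Proof. by apply/tens_piP; rewrite tens_reprK. Qed.

Definition tens_zeros : tensor := tens_pi [::].
Definition tens_add (x y : tensor) : tensor := tens_pi (repr x ++ repr y).
Definition tens_negs s := [seq (- p.1, p.2) | p <- s].
Definition tens_opp (x : tensor) : tensor := tens_pi (tens_negs (repr x)).

Lemma tens_addE s t : tens_add (tens_pi s) (tens_pi t) = tens_pi (s ++ t).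
Proof. by apply/tens_piP/tens_cat; apply: tens_repr. Qed.

Lemma tens_addA : associative tens_add.
Proof.
move=> x y z; rewrite -[x]tens_reprK -[y]tens_reprK -[z]tens_reprK.
by rewrite !tens_addE catA.
Qed.
Lemma tens_addC : commutative tens_add.
Proof. by move=> x y; apply/tens_piP/tens_comm. Qed.
Lemma tens_add0 : left_id tens_zeros tens_add.
Proof. by move=> x; rewrite -[x]tens_reprK tens_addE. Qed.

Lemma tens_negs_rel s : tens_rel (tens_negs s ++ s) [::].
Proof.
elim: s => [|[m n] s IHs] /=; first exact: tens_refl.
rewrite -cat1s -[(m, n) :: s]cat1s catA.
apply: (@tens_trans _ ((tens_negs s ++ [:: (- m, n)]) ++ ([:: (m, n)] ++ s))).
  by rewrite -!catA; rewrite (catA [:: _]) (catA (tens_negs s));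
     apply: tens_cat; [apply: tens_comm|apply: tens_refl].
rewrite -catA; apply: tens_trans IHs.
apply: tens_cat; first exact: tens_refl.
rewrite catA -[X in tens_rel _ X]cat0s; apply: tens_cat; last exact: tens_refl.
apply: tens_trans (tens_zero n); rewrite -(addNr m).
exact/tens_sym/tens_addl.
Qed.

Lemma tens_addN : left_inverse tens_zeros tens_opp tens_add.
Proof.
move=> x; rewrite -{2}[x]tens_reprK tens_addE.
exact/tens_piP/tens_negs_rel.
Qed.

HB.instance Definition _ :=
  GRing.isZmodule.Build tensor tens_addA tens_addC tens_add0 tens_addN.

Lemma tens_piD s t : tens_pi (s ++ t) = tens_pi s + tens_pi t.
Proof. by rewrite -tens_addE. Qed.

End Tensor.

Section TensorMap.
Variables (R : pzRingType) (M : lmodType R^c) (N N' : lmodType R).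
Variable f : {linear N -> N'}.

Definition tens_map (x : tensor M N) : tensor M N' :=
  tens_pi [seq (p.1, f p.2) | p <- repr x].

Lemma tens_mapE s : tens_map (tens_pi s) = tens_pi [seq (p.1, f p.2) | p <- s].
Proof.
apply/tens_piP; move: (repr _) (tens_repr s) => t ts.
elim: ts => {s t} /=.
- by move=> s; apply: tens_refl.
- by move=> s t _; apply: tens_sym.
- by move=> s t r _ IH1 _; apply: tens_trans.
- by move=> s s' t t' _ IH1 _ IH2; rewrite !map_cat; apply: tens_cat.
- by move=> s t; rewrite !map_cat; apply: tens_comm.
- by move=> n; apply: tens_zero.
- by move=> m m' n; apply: tens_addl.
- by move=> m n n'; rewrite linearD; apply: tens_addr.
- by move=> a m n; rewrite linearZ; apply: tens_bal.
Qed.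

Lemma tens_map_zmod_morphism : {morph tens_map : x y / x + y}.
Proof.
move=> x y; rewrite -[x]tens_reprK -[y]tens_reprK -tens_piD !tens_mapE.
by rewrite map_cat tens_piD.
Qed.

End TensorMap.

Section Epimorphism.
Variables (R U : pzRingType) (u : {rmorphism R -> U}).

Definition tens_mult (x : tensor (rres u) (lres u)) : U :=
  \sum_(p <- repr x) (p.1 : U) * (p.2 : U).

Lemma tens_multE s : tens_mult (tens_pi s) = \sum_(p <- s) (p.1 : U) * (p.2 : U).
Proof.
rewrite /tens_mult; move: (repr _) (tens_repr s) => t ts.
elim: ts => {s t} //=.
- by move=> s t r _ -> _ ->.
- by move=> s s' t t' _ IH1 _ IH2; rewrite !big_cat /= IH1 IH2.
- by move=> s t; rewrite !big_cat /= addrC.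
- by move=> n; rewrite big_seq1 big_nil mul0r.
- by move=> m m' n; rewrite !big_cons big_nil !addr0 mulrDl.
- by move=> m n n'; rewrite !big_cons big_nil !addr0 mulrDr.
- by move=> a m n; rewrite !big_seq1 /= mulrA.
Qed.

(* This is equivalent to u being an epimorphism in the category of rings. *)
Definition ring_epimorphism : Prop := bijective tens_mult.

End Epimorphism.

Definition projective (R : pzRingType) (P : lmodType R) : Prop :=
  forall (A B : lmodType R) (g : {linear A -> B}) (f : {linear P -> B}),
    (forall b, exists a, g a = b) ->
    exists h : {linear P -> A}, forall x, g (h x) = f x.

Record proj_resolution (R : pzRingType) (N : lmodType R) := ProjResolution {
  res_ob :> nat -> lmodType R;
  res_d : forall n, {linear res_ob n.+1 -> res_ob n};
  res_aug : {linear res_ob 0 -> N};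
  res_proj : forall n, projective (res_ob n);
  res_aug_surj : forall y, exists x, res_aug x = y;
  res_exact0 : forall x, res_aug x = 0 <-> exists y, res_d 0 y = x;
  res_exactS : forall n x, res_d n x = 0 <-> exists y, res_d n.+1 y = x
}.

Definition proj_dim_le (R : pzRingType) (N : lmodType R) (d : nat) : Prop :=
  exists P : proj_resolution N, forall n, (d < n)%N -> forall x : P n, x = 0.

Section Tor.
Variables (R : pzRingType) (M : lmodType R^c) (N : lmodType R).

Definition tens_cycle (P : proj_resolution N) (n : nat) : tensor M (P n) -> Prop :=
  match n return tensor M (P n) -> Prop with
  | 0 => fun _ => True
  | n'.+1 => fun t => tens_map (res_d P n') t = 0
  end.

(* Tor_n^R(M, N) = 0, i.e. H_n(M ⊗_R P) = 0 for a projective resolution P of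
   N; this does not depend on the choice of P. *)
Definition Tor_vanishes (n : nat) : Prop :=
  exists P : proj_resolution N, forall t : tensor M (P n),
    tens_cycle t -> exists s, tens_map (res_d P n) s = t.

End Tor.

(* The differential is given for every pair of degrees and vanishes unless the
   second is the successor of the first, so that no transport along equalities
   of degrees is needed. *)
Record bcomplex (R : pzRingType) := BComplex {
  cx_ob :> int -> lmodType R;
  cx_d : forall i j, {linear cx_ob i -> cx_ob j};
  cx_shape : forall i j, j != i + 1 -> forall x, cx_d i j x = 0;
  cx_dd : forall i j k x, cx_d j k (cx_d i j x) = 0;
  cx_bounded : exists b : nat, forall i, (b < `|i|)%N -> forall x : cx_ob i, x = 0
}.

Record chmap (R : pzRingType) (X Y : bcomplex R) := ChMap {
  chmap_at :> forall i, {linear X i -> Y i};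
  chmap_comm : forall i j x, chmap_at j (cx_d X i j x) = cx_d Y i j (chmap_at i x)
}.

Lemma chmap_ext (R : pzRingType) (X Y : bcomplex R) (f g : chmap X Y) :
  (forall i, f i =1 g i) -> f = g.
Proof.
move: f g => [f cf] [g cg] /= fg.
have efg : f = g.
  by apply: functional_extensionality_dep => i; apply: linear_ext; apply: fg.
by move: cg; rewrite -efg => cg; rewrite (Prop_irrelevance cf cg).
Qed.

Definition chmap_id (R : pzRingType) (X : bcomplex R) : chmap X X :=
  @ChMap R X X (fun i => idfun) (fun i j x => erefl).

Lemma chmap_comp_comm (R : pzRingType) (X Y Z : bcomplex R)
    (g : chmap Y Z) (f : chmap X Y) i j x :
  g j (f j (cx_d X i j x)) = cx_d Z i j (g i (f i x)).
Proof. by rewrite !chmap_comm. Qed.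

Definition chmap_comp (R : pzRingType) (X Y Z : bcomplex R)
    (g : chmap Y Z) (f : chmap X Y) : chmap X Z :=
  @ChMap R X Z (fun i => g i \o f i) (chmap_comp_comm g f).

Section Cohomology.
Variables (R : pzRingType) (X : bcomplex R) (n : int).

Definition is_cocycle : {pred X n} := fun x => cx_d X n (n + 1) x == 0.

Lemma is_cocycle_closed : submod_closed is_cocycle.
Proof.
split=> [|a x y]; rewrite !unfold_in /is_cocycle ?linear0 //.
by move=> /eqP dx /eqP dy; rewrite linearP dx dy scaler0 addr0.
Qed.
HB.instance Definition _ := GRing.isSubmodClosed.Build R (X n) is_cocycle
  is_cocycle_closed.

Record cocycle := Cocycle { cocycle_val : X n; _ : cocycle_val \in is_cocycle }.
HB.instance Definition _ := [isSub for cocycle_val].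
HB.instance Definition _ := [Choice of cocycle by <:].
HB.instance Definition _ := [SubChoice_isSubLmodule of cocycle by <:].

Definition is_coboundary : {pred cocycle} :=
  fun z => `[< exists y, cx_d X (n - 1) n y = val z >].

Lemma is_coboundary_closed : zmod_closed is_coboundary.
Proof.
split=> [|z w]; first by apply/asboolP; exists 0; rewrite linear0.
move=> /asboolP[x dx] /asboolP[y dy].
by apply/asboolP; exists (x - y); rewrite linearB dx dy.
Qed.
HB.instance Definition _ := GRing.isZmodClosed.Build cocycle is_coboundary
  is_coboundary_closed.

Definition cohomology : Type := Quotient.quot is_coboundary.
HB.instance Definition _ := GRing.Zmodule.on cohomology.

Definition coh_class (z : cocycle) : cohomology := \pi_(Quotient.quot is_coboundary) z.

Lemma coh_classP z w :
  coh_class z = coh_class w <-> exists y, cx_d X (n - 1) n y = val z - val w.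
Proof.
rewrite /coh_class; split=> [/eqP|zw].
  by rewrite -Quotient.idealrBE => /asboolP.
by apply/eqP; rewrite -Quotient.idealrBE; apply/asboolP.
Qed.

Lemma coh_reprK c : coh_class (repr c) = c.
Proof. exact: reprK. Qed.

Lemma coh_classD : {morph coh_class : z w / z + w}.
Proof. by move=> z w; rewrite /coh_class raddfD. Qed.

Lemma coh_class0 : coh_class 0 = 0.
Proof. by rewrite /coh_class raddf0. Qed.

Definition coh_scale (a : R) (c : cohomology) : cohomology :=
  coh_class (a *: repr c).

Lemma coh_scaleE a z : coh_scale a (coh_class z) = coh_class (a *: z).
Proof.
apply/coh_classP; have /coh_classP[y dy] := coh_reprK (coh_class z).
by exists (a *: y); rewrite linearZ /= dy scalerBr.
Qed.

Lemma coh_scaleA a b c : coh_scale a (coh_scale b c) = coh_scale (a * b) c.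
Proof. by rewrite -[c]coh_reprK !coh_scaleE scalerA. Qed.
Lemma coh_scale1 : left_id 1 coh_scale.
Proof. by move=> c; rewrite -[c]coh_reprK !coh_scaleE scale1r. Qed.
Lemma coh_scaleDr : right_distributive coh_scale +%R.
Proof.
move=> a b c; rewrite -[b]coh_reprK -[c]coh_reprK -coh_classD !coh_scaleE.
by rewrite scalerDr coh_classD.
Qed.
Lemma coh_scaleDl c : {morph coh_scale^~ c : a b / a + b}.
Proof.
by move=> a b; rewrite -[c]coh_reprK !coh_scaleE scalerDl coh_classD.
Qed.
HB.instance Definition _ := GRing.Zmodule_isLmodule.Build R cohomology
  coh_scaleA coh_scale1 coh_scaleDr coh_scaleDl.

Lemma coh_classZ a z : coh_class (a *: z) = a *: coh_class z.
Proof. by rewrite -coh_scaleE. Qed.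

End Cohomology.
Arguments is_cocycle {R} X n.
Arguments is_coboundary {R} X n.

Section CohomologyMap.
Variables (R : pzRingType) (X Y : bcomplex R) (n : int).

Lemma chmap_cocycle (f : chmap X Y) (z : cocycle X n) : f n (val z) \in is_cocycle Y n.
Proof.
rewrite unfold_in /is_cocycle -chmap_comm.
by case: z => z /= /eqP ->; rewrite linear0.
Qed.

Definition cocycle_map (f : chmap X Y) (z : cocycle X n) : cocycle Y n :=
  Cocycle (chmap_cocycle f z).

Definition coh_map_fun (f : chmap X Y) (c : cohomology X n) : cohomology Y n :=
  coh_class (cocycle_map f (repr c)).

Lemma coh_map_class f z : coh_map_fun f (coh_class z) = coh_class (cocycle_map f z).
Proof.
apply/coh_classP; have /coh_classP[y dy] := coh_reprK (coh_class z).
by exists (f _ y); rewrite -chmap_comm dy linearB.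
Qed.

Lemma coh_map_linear f : linear (coh_map_fun f).
Proof.
move=> a c d; rewrite -[c]coh_reprK -[d]coh_reprK -coh_classZ -coh_classD.
rewrite !coh_map_class -coh_classZ -coh_classD; congr coh_class.
by apply: val_inj => /=; rewrite linearP.
Qed.
HB.instance Definition _ (f : chmap X Y) :=
  GRing.isLinear.Build R _ _ _ (coh_map_fun f) (coh_map_linear f).

Definition coh_map (f : chmap X Y) : {linear cohomology X n -> cohomology Y n} :=
  coh_map_fun f.

End CohomologyMap.

Definition quasi_iso (R : pzRingType) (X Y : bcomplex R) (s : chmap X Y) : Prop :=
  forall n, bijective (coh_map n s).


Section CohomologyFacts.
Variable R : pzRingType.
Implicit Types X Y Z : bcomplex R.

Lemma coh_map_id X n : coh_map n (chmap_id X) = idfun.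
Proof.
apply: linear_ext => c; rewrite -[c]coh_reprK /= coh_map_class.
by congr coh_class; apply: val_inj.
Qed.

Lemma coh_map_comp X Y Z n (g : chmap Y Z) (f : chmap X Y) :
  coh_map n (chmap_comp g f) = coh_map n g \o coh_map n f.
Proof.
apply: linear_ext => c; rewrite -[c]coh_reprK /= !coh_map_class.
by congr coh_class; apply: val_inj.
Qed.

Lemma quasi_isoP X Y (s : chmap X Y) : quasi_iso s <-> forall n,
  (forall x, cx_d X n (n + 1) x = 0 ->
     (exists y, cx_d Y (n - 1) n y = s n x) -> exists y, cx_d X (n - 1) n y = x)
  /\ (forall y, cx_d Y n (n + 1) y = 0 -> exists x z,
     cx_d X n (n + 1) x = 0 /\ y = s n x + cx_d Y (n - 1) n z).
Proof.
split=> [qs n|qs n].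
  have bs := qs n; split=> [x dx [y dy]|y dy].
    have zx : x \in is_cocycle X n by apply/eqP.
    have : coh_map n s (coh_class (Cocycle zx)) = coh_map n s (coh_class 0).
      rewrite /= !coh_map_class; apply/coh_classP; exists y.
      by rewrite dy /= linear0 subr0.
    move=> /(bij_inj bs) /coh_classP[w dw].
    by exists w; rewrite dw /= subr0.
  have zy : y \in is_cocycle Y n by apply/eqP.
  have [g _ gK] := bs; have := gK (coh_class (Cocycle zy)).
  set c := g _; rewrite -[c]coh_reprK /= coh_map_class => /coh_classP[w dw].
  exists (val (repr c)), (- w); split; last by rewrite linearN dw /= opprB addrC subrK.
  by case: (repr c) => /= z /eqP.
have [inj_s surj_s] := qs n; apply: inj_surj_bij.
- apply: raddf_inj => c; rewrite -[c]coh_reprK; case: (repr c) => x zx.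
  rewrite /= coh_map_class -!coh_class0 => /coh_classP[y]; rewrite subr0 => dy.
  have [||w dw] := inj_s x; first exact/eqP; first by exists y.
  by apply/coh_classP; exists w; rewrite subr0.
- move=> c; rewrite -[c]coh_reprK; case: (repr c) => y zy.
  have [|x [z [dx ey]]] := surj_s y; first exact/eqP.
  have zx : x \in is_cocycle X n by apply/eqP.
  exists (coh_class (Cocycle zx)); rewrite /= coh_map_class.
  apply/coh_classP; exists (- z).
  by rewrite /= ey linearN opprD addNKr.
Qed.

End CohomologyFacts.

Section LinearSums.
Variables (R : pzRingType) (A A' B B' : lmodType R).

Definition lsum (f : {linear A -> A'}) (g : {linear B -> B'})
  (p : A * B) : A' * B' := (f p.1, g p.2).
Lemma lsum_linear f g : linear (lsum f g).
Proof. by move=> a p q; rewrite /lsum /= !linearP. Qed.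
HB.instance Definition _ f g :=
  GRing.isLinear.Build R _ _ _ (lsum f g) (lsum_linear f g).

Definition linl (a : A) : A * B := (a, 0).
Lemma linl_linear : linear linl.
Proof. by move=> a x y; congr (_, _) => /=; rewrite scaler0 addr0. Qed.
HB.instance Definition _ := GRing.isLinear.Build R _ _ _ linl linl_linear.

Definition linr (b : B) : A * B := (0, b).
Lemma linr_linear : linear linr.
Proof. by move=> a x y; congr (_, _) => /=; rewrite scaler0 addr0. Qed.
HB.instance Definition _ := GRing.isLinear.Build R _ _ _ linr linr_linear.

Definition ldiag (a : A) : A * A := (a, a).
Lemma ldiag_linear : linear ldiag. Proof. by []. Qed.
HB.instance Definition _ := GRing.isLinear.Build R _ _ _ ldiag ldiag_linear.

Definition lcodiag (p : A * A) : A := p.1 + p.2.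
Lemma lcodiag_linear : linear lcodiag.
Proof. by move=> a p q; rewrite /lcodiag /= scalerDr addrACA. Qed.
HB.instance Definition _ := GRing.isLinear.Build R _ _ _ lcodiag lcodiag_linear.

End LinearSums.

Section Sums.
Variable R : pzRingType.
Implicit Types X Y Z W : bcomplex R.

Section Bsum.
Variables X Y : bcomplex R.
Let d i j : {linear (X i * Y i)%type -> (X j * Y j)%type} :=
  lsum (cx_d X i j) (cx_d Y i j).

Lemma bsum_shape i j : j != i + 1 -> forall p, d i j p = 0.
Proof. by move=> ij p; rewrite /d /= /lsum !cx_shape. Qed.

Lemma bsum_dd i j k p : d j k (d i j p) = 0.
Proof. by rewrite /d /= /lsum /= !cx_dd. Qed.

Lemma bsum_bounded :
  exists b : nat, forall i, (b < `|i|)%N -> forall p : X i * Y i, p = 0.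
Proof.
have [[b Xb] [c Yc]] := (cx_bounded X, cx_bounded Y).
exists (maxn b c) => i; rewrite gtn_max => /andP[bi ci] [x y].
by rewrite (Xb i bi x) (Yc i ci y).
Qed.

Definition bsum : bcomplex R := BComplex bsum_shape bsum_dd bsum_bounded.
End Bsum.

Definition chmap_sum X X' Y Y' (f : chmap X X') (g : chmap Y Y') :
  chmap (bsum X Y) (bsum X' Y').
Proof.
apply: (@ChMap _ (bsum X Y) (bsum X' Y') (fun i => lsum (f i) (g i))).
by move=> i j [x y]; congr (_, _); apply: chmap_comm.
Defined.

Definition chmap_inl X Y : chmap X (bsum X Y).
Proof.
apply: (@ChMap _ X (bsum X Y) (fun i => @linl R (X i) (Y i))).
by move=> i j x; congr (_, _); rewrite linear0.
Defined.

Definition chmap_inr X Y : chmap Y (bsum X Y).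
Proof.
apply: (@ChMap _ Y (bsum X Y) (fun i => @linr R (X i) (Y i))).
by move=> i j x; congr (_, _); rewrite linear0.
Defined.

Definition chmap_diag X : chmap X (bsum X X).
Proof. exact: (@ChMap _ X (bsum X X) (fun i => @ldiag R (X i))). Defined.

Definition chmap_codiag X : chmap (bsum X X) X.
Proof.
apply: (@ChMap _ (bsum X X) X (fun i => @lcodiag R (X i))).
by move=> i j [x y] /=; rewrite /lcodiag /= linearD.
Defined.

Definition chmap_zero X Y : chmap X Y.
Proof.
apply: (@ChMap _ X Y (fun i => \0)).
by move=> i j x; rewrite linear0.
Defined.

Definition chmap_opp X : chmap X X.
Proof.
apply: (@ChMap _ X X (fun i => \- idfun)).
by move=> i j x /=; rewrite linearN.
Defined.

Lemma quasi_iso_id X : quasi_iso (chmap_id X).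
Proof. by move=> n; rewrite coh_map_id; exists id. Qed.

Lemma quasi_iso_sum X X' Y Y' (f : chmap X X') (g : chmap Y Y') :
  quasi_iso f -> quasi_iso g -> quasi_iso (chmap_sum f g).
Proof.
move=> /quasi_isoP qf /quasi_isoP qg; apply/quasi_isoP => n.
have [inj_f surj_f] := qf n; have [inj_g surj_g] := qg n; split.
- move=> [x y] [dx dy] [[x' y'] [ex ey]].
  have [|x1 <-] := inj_f x dx; first by exists x'.
  have [|y1 <-] := inj_g y dy; first by exists y'.
  by exists (x1, y1).
- move=> [x y] [dx dy].
  have [x1 [x2 [dx1 ->]]] := surj_f x dx.
  have [y1 [y2 [dy1 ->]]] := surj_g y dy.
  by exists (x1, y1), (x2, y2); split => //; rewrite /= /lsum /= dx1 dy1.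
Qed.

End Sums.

(* D^b(R-mod) is the localization of the category of bounded complexes at the
   class of quasi-isomorphisms: a morphism is a formal composite of chain maps
   and of formal inverses of quasi-isomorphisms, modulo the congruence
   generated by the composition of chain maps and by the fact that the formal
   inverses are inverses. *)
Inductive zigzag (R : pzRingType) : bcomplex R -> bcomplex R -> Type :=
| zz_map X Y (f : chmap X Y) : zigzag X Y
| zz_inv X Y (s : chmap X Y) (qs : quasi_iso s) : zigzag Y X
| zz_comp X Y Z (g : zigzag Y Z) (f : zigzag X Y) : zigzag X Z.

Inductive zz_eq (R : pzRingType) :
  forall X Y : bcomplex R, zigzag X Y -> zigzag X Y -> Prop :=
| zz_refl X Y (f : zigzag X Y) : zz_eq f f
| zz_sym X Y (f g : zigzag X Y) : zz_eq f g -> zz_eq g f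
| zz_trans X Y (f g h : zigzag X Y) : zz_eq f g -> zz_eq g h -> zz_eq f h
| zz_cong X Y Z (g g' : zigzag Y Z) (f f' : zigzag X Y) :
    zz_eq g g' -> zz_eq f f' -> zz_eq (zz_comp g f) (zz_comp g' f')
| zz_assoc X Y Z W (h : zigzag Z W) (g : zigzag Y Z) (f : zigzag X Y) :
    zz_eq (zz_comp h (zz_comp g f)) (zz_comp (zz_comp h g) f)
| zz_idl X Y (f : zigzag X Y) : zz_eq (zz_comp (zz_map (chmap_id Y)) f) f
| zz_idr X Y (f : zigzag X Y) : zz_eq (zz_comp f (zz_map (chmap_id X))) f
| zz_map_comp X Y Z (g : chmap Y Z) (f : chmap X Y) :
    zz_eq (zz_comp (zz_map g) (zz_map f)) (zz_map (chmap_comp g f))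
| zz_invl X Y (s : chmap X Y) (qs : quasi_iso s) :
    zz_eq (zz_comp (zz_inv qs) (zz_map s)) (zz_map (chmap_id X))
| zz_invr X Y (s : chmap X Y) (qs : quasi_iso s) :
    zz_eq (zz_comp (zz_map s) (zz_inv qs)) (zz_map (chmap_id Y)).


Section DerivedCategory.
Variable R : pzRingType.
Implicit Types X Y Z W : bcomplex R.

(* Hom_{D^b(R-mod)}(X, Y), as the set of equivalence classes of zigzags. *)
Definition Dhom X Y : Type :=
  {c : zigzag X Y -> Prop | exists z, c = zz_eq z}.

Lemma Dhom_ext X Y (f g : Dhom X Y) : sval f = sval g -> f = g.
Proof.
move: f g => [c cP] [d dP] /= ecd; move: dP; rewrite -ecd => dP.
by rewrite (Prop_irrelevance cP dP).
Qed.

Definition Dclass X Y (z : zigzag X Y) : Dhom X Y :=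
  exist _ (zz_eq z) (ex_intro _ z erefl).

Definition Drepr X Y (f : Dhom X Y) : zigzag X Y := sval (cid (svalP f)).

Lemma DreprK X Y (f : Dhom X Y) : Dclass (Drepr f) = f.
Proof. by apply: Dhom_ext; rewrite /= /Drepr; case: cid. Qed.

Lemma DclassP X Y (z w : zigzag X Y) : Dclass z = Dclass w <-> zz_eq z w.
Proof.
split=> [/(congr1 sval) /= ->|zw]; first exact: zz_refl.
apply: Dhom_ext => /=; apply/funext => v; apply/propext; split.
  exact/zz_trans/zz_sym.
exact: zz_trans.
Qed.

Definition Dmap X Y (f : chmap X Y) : Dhom X Y := Dclass (zz_map f).
Definition Dinv X Y (s : chmap X Y) (qs : quasi_iso s) : Dhom Y X :=
  Dclass (zz_inv qs).
Definition Did X : Dhom X X := Dmap (chmap_id X).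
Definition Dcomp X Y Z (g : Dhom Y Z) (f : Dhom X Y) : Dhom X Z :=
  Dclass (zz_comp (Drepr g) (Drepr f)).

Local Notation "g \oD f" := (Dcomp g f) (at level 50, left associativity).

Lemma Dclass_comp X Y Z (g : zigzag Y Z) (f : zigzag X Y) :
  Dclass (zz_comp g f) = Dclass g \oD Dclass f.
Proof. by apply/DclassP; apply: zz_cong; apply/DclassP; rewrite DreprK. Qed.

Lemma DcompA X Y Z W (h : Dhom Z W) (g : Dhom Y Z) (f : Dhom X Y) :
  h \oD (g \oD f) = h \oD g \oD f.
Proof.
rewrite -(DreprK h) -(DreprK g) -(DreprK f) -!Dclass_comp.
exact/DclassP/zz_assoc.
Qed.

Lemma Dcomp1l X Y (f : Dhom X Y) : Did Y \oD f = f.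
Proof. by rewrite -(DreprK f) -Dclass_comp; apply/DclassP/zz_idl. Qed.

Lemma Dcomp1r X Y (f : Dhom X Y) : f \oD Did X = f.
Proof. by rewrite -(DreprK f) -Dclass_comp; apply/DclassP/zz_idr. Qed.

Lemma Dmap_comp X Y Z (g : chmap Y Z) (f : chmap X Y) :
  Dmap g \oD Dmap f = Dmap (chmap_comp g f).
Proof. by rewrite -Dclass_comp; apply/DclassP/zz_map_comp. Qed.

Lemma DinvK X Y (s : chmap X Y) (qs : quasi_iso s) : Dinv qs \oD Dmap s = Did X.
Proof. by rewrite -Dclass_comp; apply/DclassP/zz_invl. Qed.

Lemma DinvVK X Y (s : chmap X Y) (qs : quasi_iso s) : Dmap s \oD Dinv qs = Did Y.
Proof. by rewrite -Dclass_comp; apply/DclassP/zz_invr. Qed.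

Lemma Dhom_ind (P : forall X Y, Dhom X Y -> Prop) :
  (forall X Y (f : chmap X Y), P X Y (Dmap f)) ->
  (forall X Y (s : chmap X Y) (qs : quasi_iso s), P Y X (Dinv qs)) ->
  (forall X Y Z (g : Dhom Y Z) (f : Dhom X Y),
     P Y Z g -> P X Y f -> P X Z (g \oD f)) ->
  forall X Y (f : Dhom X Y), P X Y f.
Proof.
move=> Pmap Pinv Pcomp X Y f; rewrite -(DreprK f).
elim: {f} (Drepr f) => [{}X {}Y f|{}X {}Y s qs|{}X {}Y Z g Pg f Pf].
- exact: Pmap.
- exact: Pinv.
- by rewrite Dclass_comp; apply: Pcomp.
Qed.

Lemma Dmap_quasi_iso_monic X Y Z (s : chmap Y Z) (f g : Dhom X Y) :
  quasi_iso s -> Dmap s \oD f = Dmap s \oD g -> f = g.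
Proof.
move=> qs /(congr1 (Dcomp (Dinv qs))).
by rewrite !DcompA !DinvK !Dcomp1l.
Qed.

Lemma Dmap_quasi_iso_epic X Y Z (s : chmap X Y) (f g : Dhom Y Z) :
  quasi_iso s -> f \oD Dmap s = g \oD Dmap s -> f = g.
Proof.
move=> qs /(congr1 (fun h => h \oD Dinv qs)) /=.
by rewrite -!DcompA !DinvVK !Dcomp1r.
Qed.

Fixpoint zz_coh n X Y (z : zigzag X Y) :
    {linear cohomology X n -> cohomology Y n} :=
  match z in zigzag X Y return {linear cohomology X n -> cohomology Y n} with
  | zz_map X Y f => coh_map n f
  | zz_inv X Y s qs => lin_inv (qs n)
  | zz_comp X Y Z g f => zz_coh n g \o zz_coh n f
  end.

Lemma zz_coh_eq n X Y (z w : zigzag X Y) : zz_eq z w -> zz_coh n z = zz_coh n w.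
Proof.
elim=> {X Y z w} //=.
- by move=> X Y f g h _ -> _ ->.
- by move=> X Y Z g g' f f' _ -> _ ->.
- by move=> X Y Z W h g f; apply: linear_ext.
- by move=> X Y f; rewrite coh_map_id; apply: linear_ext.
- by move=> X Y f; rewrite coh_map_id; apply: linear_ext.
- by move=> X Y Z g f; rewrite coh_map_comp.
- move=> X Y s qs; rewrite coh_map_id; apply: linear_ext => c.
  exact: (lin_invKV (qs n)).
- move=> X Y s qs; rewrite coh_map_id; apply: linear_ext => c.
  exact: (lin_invK (qs n)).
Qed.

Definition Dcoh n X Y (f : Dhom X Y) :
  {linear cohomology X n -> cohomology Y n} := zz_coh n (Drepr f).

Lemma Dcoh_class n X Y (z : zigzag X Y) : Dcoh n (Dclass z) = zz_coh n z.
Proof. by apply/zz_coh_eq/DclassP/DreprK. Qed.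

Lemma Dcoh_map n X Y (f : chmap X Y) : Dcoh n (Dmap f) = coh_map n f.
Proof. exact: Dcoh_class. Qed.

Lemma Dcoh_id n X : Dcoh n (Did X) = idfun.
Proof. by rewrite Dcoh_map coh_map_id. Qed.

Lemma Dcoh_comp n X Y Z (g : Dhom Y Z) (f : Dhom X Y) :
  Dcoh n (g \oD f) = Dcoh n g \o Dcoh n f.
Proof. by rewrite Dcoh_class. Qed.

Record cx_functor := CxFunctor {
  cxf_ob :> bcomplex R -> bcomplex R;
  cxf_map : forall X Y, chmap X Y -> chmap (cxf_ob X) (cxf_ob Y);
  cxf_id : forall X, cxf_map (chmap_id X) = chmap_id (cxf_ob X);
  cxf_comp : forall X Y Z (g : chmap Y Z) (f : chmap X Y),
    cxf_map (chmap_comp g f) = chmap_comp (cxf_map g) (cxf_map f);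
  cxf_qis : forall X Y (s : chmap X Y), quasi_iso s -> quasi_iso (cxf_map s)
}.

Fixpoint zz_lift (F : cx_functor) X Y (z : zigzag X Y) : zigzag (F X) (F Y) :=
  match z in zigzag X Y return zigzag (F X) (F Y) with
  | zz_map X Y f => zz_map (cxf_map F f)
  | zz_inv X Y s qs => zz_inv (cxf_qis F qs)
  | zz_comp X Y Z g f => zz_comp (zz_lift F g) (zz_lift F f)
  end.

Lemma zz_lift_eq F X Y (z w : zigzag X Y) :
  zz_eq z w -> zz_eq (zz_lift F z) (zz_lift F w).
Proof.
elim=> {X Y z w} /=.
- by move=> *; apply: zz_refl.
- by move=> X Y f g _; apply: zz_sym.
- by move=> X Y f g h _ fg _; apply: zz_trans.
- by move=> *; apply: zz_cong.
- by move=> *; apply: zz_assoc.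
- by move=> *; rewrite cxf_id; apply: zz_idl.
- by move=> *; rewrite cxf_id; apply: zz_idr.
- by move=> *; rewrite cxf_comp; apply: zz_map_comp.
- by move=> *; rewrite cxf_id; apply: zz_invl.
- by move=> *; rewrite cxf_id; apply: zz_invr.
Qed.

Definition Dlift (F : cx_functor) X Y (f : Dhom X Y) : Dhom (F X) (F Y) :=
  Dclass (zz_lift F (Drepr f)).

Lemma Dlift_class F X Y (z : zigzag X Y) :
  Dlift F (Dclass z) = Dclass (zz_lift F z).
Proof. by apply/DclassP/zz_lift_eq/DclassP/DreprK. Qed.

Lemma Dlift_map F X Y (f : chmap X Y) : Dlift F (Dmap f) = Dmap (cxf_map F f).
Proof. exact: Dlift_class. Qed.

Lemma Dlift_id F X : Dlift F (Did X) = Did (F X).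
Proof. by rewrite Dlift_map cxf_id. Qed.

Lemma Dlift_comp F X Y Z (g : Dhom Y Z) (f : Dhom X Y) :
  Dlift F (g \oD f) = Dlift F g \oD Dlift F f.
Proof. by rewrite Dlift_class /= Dclass_comp. Qed.

Lemma Dlift_invK F X Y (s : chmap X Y) (qs : quasi_iso s) :
  Dlift F (Dinv qs) \oD Dmap (cxf_map F s) = Did (F X).
Proof. by rewrite -Dlift_map -Dlift_comp DinvK Dlift_id. Qed.

Lemma Dlift_nat (F G : cx_functor) (t : forall X, chmap (F X) (G X)) :
  (forall X Y (f : chmap X Y),
     chmap_comp (t Y) (cxf_map F f) = chmap_comp (cxf_map G f) (t X)) ->
  forall X Y (f : Dhom X Y),
    Dmap (t Y) \oD Dlift F f = Dlift G f \oD Dmap (t X).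
Proof.
move=> nat_t; apply: (@Dhom_ind (fun X Y f =>
  Dmap (t Y) \oD Dlift F f = Dlift G f \oD Dmap (t X)))
  => [X Y f|X Y s qs|X Y Z g f IHg IHf].
- by rewrite !Dlift_map !Dmap_comp nat_t.
- apply: (Dmap_quasi_iso_epic (cxf_qis F qs)).
  rewrite -DcompA -Dlift_map -Dlift_comp DinvK Dlift_id Dcomp1r.
  rewrite -DcompA Dlift_map Dmap_comp nat_t -Dmap_comp DcompA -Dlift_map.
  by rewrite -Dlift_comp DinvK Dlift_id Dcomp1l.
- by rewrite !Dlift_comp DcompA IHg -DcompA IHf DcompA.
Qed.

Definition id_functor : cx_functor :=
  @CxFunctor id (fun _ _ f => f) (fun _ => erefl)
    (fun _ _ _ _ _ => erefl) (fun _ _ _ qs => qs).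

Definition const_functor (C : bcomplex R) : cx_functor.
Proof.
apply: (@CxFunctor (fun=> C) (fun _ _ _ => chmap_id C)) => //.
- by move=> *; apply: chmap_ext.
- by move=> *; apply: quasi_iso_id.
Defined.

Definition suml_functor Y : cx_functor.
Proof.
apply: (@CxFunctor (fun X => bsum X Y) (fun X X' f => chmap_sum f (chmap_id Y))).
- by move=> X; apply: chmap_ext => i [].
- by move=> *; apply: chmap_ext => i [].
- by move=> X X' s qs; apply: quasi_iso_sum => //; apply: quasi_iso_id.
Defined.

Definition sumr_functor X : cx_functor.
Proof.
apply: (@CxFunctor (bsum X) (fun Y Y' f => chmap_sum (chmap_id X) f)).
- by move=> Y; apply: chmap_ext => i [].
- by move=> *; apply: chmap_ext => i [].
- by move=> Y Y' s qs; apply: quasi_iso_sum => //; apply: quasi_iso_id.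
Defined.

Definition dbl_functor : cx_functor.
Proof.
apply: (@CxFunctor (fun X => bsum X X) (fun X X' f => chmap_sum f f)).
- by move=> X; apply: chmap_ext => i [].
- by move=> *; apply: chmap_ext => i [].
- by move=> X X' s qs; apply: quasi_iso_sum.
Defined.

Definition Dsum X X' Y Y' (f : Dhom X X') (g : Dhom Y Y') :
    Dhom (bsum X Y) (bsum X' Y') :=
  Dlift (sumr_functor X') g \oD Dlift (suml_functor Y) f.

Definition Dzero X Y : Dhom X Y := Dmap (chmap_zero X Y).
(* The addition of an additive category in terms of its biproducts:
   X -> X ⊕ X -> Y ⊕ Y -> Y. *)
Definition Dadd X Y (f g : Dhom X Y) : Dhom X Y :=
  Dmap (chmap_codiag Y) \oD Dsum f g \oD Dmap (chmap_diag X).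
Definition Dopp X Y (f : Dhom X Y) : Dhom X Y := f \oD Dmap (chmap_opp X).

Lemma Dlift_idf X Y (f : Dhom X Y) : Dlift id_functor f = f.
Proof.
rewrite -[f]DreprK Dlift_class; congr Dclass.
by elim: {f} (Drepr f) => //= {}X {}Y Z g -> f ->.
Qed.

Lemma Dlift_const C X Y (f : Dhom X Y) : Dlift (const_functor C) f = Did C.
Proof.
apply: (@Dhom_ind (fun X Y f => Dlift (const_functor C) f = Did C))
  => {X Y f} [X Y f|X Y s qs|X Y Z g f IHg IHf].
- by rewrite Dlift_map.
- by have := Dlift_invK (const_functor C) qs; rewrite Dcomp1r.
- by rewrite Dlift_comp IHg IHf Dcomp1l.
Qed.

Lemma Dlift_swap X X' Y Y' (f : Dhom X X') (g : Dhom Y Y') :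
  Dlift (sumr_functor X') g \oD Dlift (suml_functor Y) f
  = Dlift (suml_functor Y') f \oD Dlift (sumr_functor X) g.
Proof.
move: X X' f; apply: (@Dhom_ind (fun X X' f => _))
  => [X X' f|X X' s qs|X X' X'' f' f IHf' IHf].
- rewrite !Dlift_map; symmetry.
  apply: (@Dlift_nat (sumr_functor X) (sumr_functor X')
    (fun Y => chmap_sum f (chmap_id Y))) => Z Z' h.
  by apply: chmap_ext => i [].
- have nat_s : Dmap (chmap_sum s (chmap_id Y')) \oD Dlift (sumr_functor X) g
      = Dlift (sumr_functor X') g \oD Dmap (chmap_sum s (chmap_id Y)).
    apply: (@Dlift_nat (sumr_functor X) (sumr_functor X')
      (fun Y => chmap_sum s (chmap_id Y))) => Z Z' h.
    by apply: chmap_ext => i [].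
  apply: (Dmap_quasi_iso_epic (cxf_qis (suml_functor Y) qs)).
  rewrite -DcompA -Dlift_map -Dlift_comp DinvK Dlift_id Dcomp1r.
  rewrite -DcompA Dlift_map /= -nat_s DcompA.
  by rewrite (Dlift_invK (suml_functor Y')) Dcomp1l.
- by rewrite !Dlift_comp DcompA IHf' -!DcompA IHf.
Qed.

Lemma Dlift_dbl X Y (f : Dhom X Y) : Dlift dbl_functor f = Dsum f f.
Proof.
rewrite /Dsum; move: X Y f; apply: (@Dhom_ind (fun X Y f => _))
  => [X Y f|X Y s qs|X Y Z g f IHg IHf].
- rewrite !Dlift_map Dmap_comp; congr Dmap.
  by apply: chmap_ext => i [].
- apply: (Dmap_quasi_iso_epic (cxf_qis dbl_functor qs)).
  rewrite Dlift_invK.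
  have -> : Dmap (cxf_map dbl_functor s)
      = Dmap (cxf_map (suml_functor Y) s) \oD Dmap (cxf_map (sumr_functor X) s).
    by rewrite Dmap_comp; congr Dmap; apply: chmap_ext => i [].
  rewrite DcompA -[X in X \oD _]DcompA (Dlift_invK (suml_functor Y)) Dcomp1r.
  by rewrite (Dlift_invK (sumr_functor X)).
- rewrite !Dlift_comp IHg IHf !DcompA; congr (_ \oD _).
  by rewrite -!DcompA; congr (_ \oD _); rewrite Dlift_swap.
Qed.

Definition Dcopair X Y Z (f : Dhom X Z) (g : Dhom Y Z) : Dhom (bsum X Y) Z :=
  Dmap (chmap_codiag Z) \oD Dsum f g.

Lemma Dcopair_inl X Y Z (f : Dhom X Z) (g : Dhom Y Z) :
  Dcopair f g \oD Dmap (chmap_inl X Y) = f.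
Proof.
rewrite /Dcopair /Dsum -!DcompA.
rewrite -(@Dlift_nat id_functor (suml_functor Y) (fun X => chmap_inl X Y)); last first.
  by move=> ? ? h; apply: chmap_ext => i x.
rewrite Dlift_idf [X in _ \oD X]DcompA.
rewrite -(@Dlift_nat (const_functor Z) (sumr_functor Z) (fun Y => chmap_inl Z Y)).
  rewrite Dlift_const Dcomp1r DcompA Dmap_comp -[RHS]Dcomp1l; congr (_ \oD _).
  by congr Dmap; apply: chmap_ext => i x /=; rewrite /lcodiag /= addr0.
by move=> ? ? h; apply: chmap_ext => i x; congr (_, _); rewrite /= linear0.
Qed.

Lemma Dcopair_inr X Y Z (f : Dhom X Z) (g : Dhom Y Z) :
  Dcopair f g \oD Dmap (chmap_inr X Y) = g.
Proof.
rewrite /Dcopair /Dsum -!DcompA.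
rewrite -(@Dlift_nat (const_functor Y) (suml_functor Y) (fun X => chmap_inr X Y)).
  rewrite Dlift_const Dcomp1r.
  rewrite -(@Dlift_nat id_functor (sumr_functor Z) (fun Y => chmap_inr Z Y)).
    rewrite Dlift_idf DcompA Dmap_comp -[RHS]Dcomp1l; congr (_ \oD _).
    by congr Dmap; apply: chmap_ext => i x /=; rewrite /lcodiag /= add0r.
  by move=> ? ? h; apply: chmap_ext => i x.
by move=> ? ? h; apply: chmap_ext => i x; congr (_, _); rewrite /= linear0.
Qed.

Lemma Dcopair_eta X Y Z (h : Dhom (bsum X Y) Z) :
  h = Dcopair (h \oD Dmap (chmap_inl X Y)) (h \oD Dmap (chmap_inr X Y)).
Proof.
rewrite /Dcopair /Dsum !Dlift_comp.
have -> : Dlift (sumr_functor Z) h \oD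
    Dlift (sumr_functor Z) (Dmap (chmap_inr X Y)) \oD
    (Dlift (suml_functor Y) h \oD Dlift (suml_functor Y) (Dmap (chmap_inl X Y)))
  = Dlift dbl_functor h \oD
    Dmap (chmap_sum (chmap_inl X Y) (chmap_inr X Y)).
  rewrite -DcompA [X in _ \oD X]DcompA Dlift_swap Dlift_dbl /Dsum.
  rewrite !Dlift_map -!DcompA Dmap_comp; congr (_ \oD (_ \oD Dmap _)).
  by apply: chmap_ext => i [].
rewrite DcompA (@Dlift_nat dbl_functor id_functor (@chmap_codiag R)).
  rewrite Dlift_idf -DcompA Dmap_comp -[LHS]Dcomp1r; congr (_ \oD Dmap _).
  apply: chmap_ext => i [x y] /=; rewrite /lcodiag /=.
  by congr (_, _); rewrite ?addr0 ?add0r.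
by move=> ? ? f; apply: chmap_ext => i [x y] /=; rewrite /lcodiag /= linearD.
Qed.

Lemma Dcopair_uniq X Y Z (h k : Dhom (bsum X Y) Z) :
  h \oD Dmap (chmap_inl X Y) = k \oD Dmap (chmap_inl X Y) ->
  h \oD Dmap (chmap_inr X Y) = k \oD Dmap (chmap_inr X Y) -> h = k.
Proof. by move=> hl hr; rewrite (Dcopair_eta h) (Dcopair_eta k) hl hr. Qed.

Lemma DaddE X Y (f g : Dhom X Y) :
  Dadd f g = Dcopair f g \oD Dmap (chmap_diag X).
Proof. by []. Qed.

Lemma Dcomp0r X Y Z (f : Dhom Y Z) : f \oD Dzero X Y = Dzero X Z.
Proof.
move: Y Z f; apply: (@Dhom_ind (fun Y Z f => _))
  => [Y Z f|Y Z s qs|Y Z W g f IHg IHf].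
- by rewrite Dmap_comp; congr Dmap; apply: chmap_ext => i x /=; rewrite linear0.
- apply: (Dmap_quasi_iso_monic qs); rewrite DcompA DinvVK Dcomp1l Dmap_comp.
  by congr Dmap; apply: chmap_ext => i x /=; rewrite linear0.
- by rewrite -DcompA IHf IHg.
Qed.

Lemma Dcomp_copair X Y Z W (k : Dhom Z W) (f : Dhom X Z) (g : Dhom Y Z) :
  k \oD Dcopair f g = Dcopair (k \oD f) (k \oD g).
Proof.
by apply: Dcopair_uniq; rewrite -DcompA ?Dcopair_inl ?Dcopair_inr.
Qed.

Lemma DcompDr X Y Z (k : Dhom Y Z) (f g : Dhom X Y) :
  k \oD Dadd f g = Dadd (k \oD f) (k \oD g).
Proof. by rewrite !DaddE DcompA Dcomp_copair. Qed.

Lemma DcompDl X Y Z (f g : Dhom Y Z) (k : Dhom X Y) :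
  Dadd f g \oD k = Dadd (f \oD k) (g \oD k).
Proof.
have nat_diag : Dmap (chmap_diag Y) \oD k = Dlift dbl_functor k \oD Dmap (chmap_diag X).
  rewrite -(@Dlift_nat id_functor dbl_functor (@chmap_diag R)) ?Dlift_idf //.
  by move=> ? ? h; apply: chmap_ext.
rewrite !DaddE -DcompA nat_diag DcompA; congr (_ \oD _).
apply: Dcopair_uniq; rewrite ?Dcopair_inl ?Dcopair_inr -DcompA.
  rewrite -(@Dlift_nat id_functor dbl_functor (fun X => chmap_inl X X)).
    by rewrite Dlift_idf DcompA Dcopair_inl.
  by move=> ? ? h; apply: chmap_ext => i x; congr (_, _); rewrite /= linear0.
rewrite -(@Dlift_nat id_functor dbl_functor (fun X => chmap_inr X X)).
  by rewrite Dlift_idf DcompA Dcopair_inr.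
by move=> ? ? h; apply: chmap_ext => i x; congr (_, _); rewrite /= linear0.
Qed.

Lemma DaddC X Y : commutative (@Dadd X Y).
Proof.
move=> f g; pose swap := chmap_comp (chmap_codiag _)
  (chmap_sum (chmap_inr X X) (chmap_inl X X)).
have -> : Dadd g f = Dcopair g f \oD Dmap swap \oD Dmap (chmap_diag X).
  rewrite -DcompA Dmap_comp DaddE; congr (_ \oD Dmap _).
  apply: chmap_ext => i x /=.
  by congr (_, _); rewrite /= ?addr0 ?add0r.
rewrite DaddE; congr (_ \oD _).
have swapl : chmap_comp swap (chmap_inl X X) = chmap_inr X X.
  by apply: chmap_ext => i x /=; congr (_, _); rewrite /= ?addr0 ?add0r.
have swapr : chmap_comp swap (chmap_inr X X) = chmap_inl X X.
  by apply: chmap_ext => i x /=; congr (_, _); rewrite /= ?addr0 ?add0r.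
by apply: Dcopair_uniq; rewrite -[RHS]DcompA Dmap_comp ?swapl ?swapr
  ?Dcopair_inl ?Dcopair_inr.
Qed.

Lemma Dadd0 X Y (f : Dhom X Y) : Dadd f (Dzero X Y) = f.
Proof.
pose fst := chmap_comp (chmap_codiag X) (chmap_sum (chmap_id X) (chmap_zero X X)).
have -> : Dadd f (Dzero X Y) = f \oD Dmap fst \oD Dmap (chmap_diag X).
  rewrite DaddE; congr (_ \oD _); apply: Dcopair_uniq.
    rewrite Dcopair_inl -DcompA Dmap_comp -[LHS]Dcomp1r; congr (_ \oD Dmap _).
    by apply: chmap_ext => i x /=; rewrite /lcodiag /= addr0.
  rewrite Dcopair_inr -DcompA Dmap_comp -(Dcomp0r _ f); congr (_ \oD Dmap _).
  by apply: chmap_ext => i x /=; rewrite /lcodiag /= addr0.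
rewrite -DcompA Dmap_comp -[RHS]Dcomp1r; congr (_ \oD Dmap _).
by apply: chmap_ext => i x /=; rewrite /lcodiag /= addr0.
Qed.

Lemma DaddN X Y (f : Dhom X Y) : Dadd f (Dopp f) = Dzero X Y.
Proof.
rewrite /Dopp -{1}[f]Dcomp1r -DcompDr -[RHS](Dcomp0r _ f); congr (_ \oD _).
rewrite /Dadd /Dsum !Dlift_map !Dmap_comp; congr Dmap.
by apply: chmap_ext => i x /=; rewrite /lcodiag /= subrr.
Qed.

Lemma DaddA X Y : associative (@Dadd X Y).
Proof.
move=> f g h.
pose assoc : chmap (bsum (bsum X X) X) (bsum X (bsum X X)) :=
  chmap_comp (chmap_codiag _) (chmap_sum
    (chmap_comp (chmap_codiag _)
       (chmap_sum (chmap_inl _ _) (chmap_comp (chmap_inr _ _) (chmap_inl _ _))))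
    (chmap_comp (chmap_inr _ _) (chmap_inr _ _))).
have eassoc i x y z : assoc i ((x, y), z) = (x, (y, z)).
  by congr (_, (_, _)); rewrite /= ?addr0 ?add0r.
have -> : Dadd (Dadd f g) h
    = Dcopair (Dcopair f g) h \oD
      Dmap (chmap_comp (chmap_sum (chmap_diag X) (chmap_id X)) (chmap_diag X)).
  rewrite -Dmap_comp DcompA DaddE; congr (_ \oD _).
  apply: Dcopair_uniq; rewrite -DcompA Dmap_comp.
    rewrite Dcopair_inl.
    rewrite (_ : chmap_comp _ _ = chmap_comp (chmap_inl _ _) (chmap_diag X)).
      by rewrite -Dmap_comp DcompA Dcopair_inl.
    by apply: chmap_ext => i x /=; congr (_, _).
  rewrite (_ : chmap_comp _ _ = chmap_inr _ _) ?Dcopair_inr //.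
  by apply: chmap_ext => i x /=; congr (_, _).
have -> : Dadd f (Dadd g h)
    = Dcopair f (Dcopair g h) \oD
      Dmap (chmap_comp (chmap_sum (chmap_id X) (chmap_diag X)) (chmap_diag X)).
  rewrite -Dmap_comp DcompA DaddE; congr (_ \oD _).
  apply: Dcopair_uniq; rewrite -DcompA Dmap_comp.
    rewrite Dcopair_inl (_ : chmap_comp _ _ = chmap_inl _ _) ?Dcopair_inl //.
    by apply: chmap_ext => i x /=; congr (_, _).
  rewrite Dcopair_inr.
  rewrite (_ : chmap_comp _ _ = chmap_comp (chmap_inr _ _) (chmap_diag X)).
    by rewrite -Dmap_comp DcompA Dcopair_inr.
  by apply: chmap_ext => i x /=; congr (_, _).
have -> : Dcopair (Dcopair f g) h = Dcopair f (Dcopair g h) \oD Dmap assoc.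
  apply: Dcopair_uniq; rewrite -[RHS]DcompA Dmap_comp ?Dcopair_inr.
    rewrite Dcopair_inl; apply: Dcopair_uniq;
      rewrite -[RHS]DcompA Dmap_comp ?Dcopair_inl ?Dcopair_inr.
      rewrite (_ : chmap_comp _ _ = chmap_inl _ _) ?Dcopair_inl //.
      by apply: chmap_ext => i x; apply: (eassoc i x 0 0).
    rewrite (_ : chmap_comp _ _ = chmap_comp (chmap_inr _ _) (chmap_inl _ _)).
      by rewrite -Dmap_comp DcompA Dcopair_inr Dcopair_inl.
    by apply: chmap_ext => i x; apply: (eassoc i 0 x 0).
  rewrite (_ : chmap_comp _ _ = chmap_comp (chmap_inr _ _) (chmap_inr _ _)).
    by rewrite -Dmap_comp DcompA !Dcopair_inr.
  by apply: chmap_ext => i x; apply: (eassoc i 0 0 x).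
rewrite -DcompA Dmap_comp; congr (_ \oD Dmap _).
by apply: chmap_ext => i x; symmetry; apply: (eassoc i x x x).
Qed.

Lemma Dcoh_add n X Y (f g : Dhom X Y) c :
  Dcoh n (Dadd f g) c = Dcoh n f c + Dcoh n g c.
Proof.
have diagE : Dcoh n (Dmap (chmap_diag X)) c
    = Dcoh n (Dmap (chmap_inl X X)) c + Dcoh n (Dmap (chmap_inr X X)) c.
  rewrite !Dcoh_map -[c]coh_reprK /= !coh_map_class -coh_classD.
  congr coh_class; apply: val_inj => /=.
  by congr (_, _); rewrite /= ?addr0 ?add0r.
rewrite DaddE Dcoh_comp /= diagE linearD.
congr (_ + _).
  by rewrite -[X in _ = Dcoh n X c](Dcopair_inl f g) Dcoh_comp.
by rewrite -[X in _ = Dcoh n X c](Dcopair_inr f g) Dcoh_comp.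
Qed.

End DerivedCategory.

(* The Hom sets of D^b(R-mod) live in a larger universe than R-modules, hence
   cannot carry a [pzRingType] structure. *)
Record ring_on (T : Type) := RingOn {
  ring_zero : T;
  ring_one : T;
  ring_opp : T -> T;
  ring_add : T -> T -> T;
  ring_mul : T -> T -> T;
  ring_addA : associative ring_add;
  ring_addC : commutative ring_add;
  ring_add0 : left_id ring_zero ring_add;
  ring_addN : left_inverse ring_zero ring_opp ring_add;
  ring_mulA : associative ring_mul;
  ring_mul1 : left_id ring_one ring_mul;
  ring_mulr1 : right_id ring_one ring_mul;
  ring_mulDl : left_distributive ring_mul ring_add;
  ring_mulDr : right_distributive ring_mul ring_add
}.

Definition is_ring_hom (T : Type) (A : ring_on T) (B : pzRingType) (f : T -> B)
  : Prop :=
  [/\ f (ring_one A) = 1,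
      {morph f : x y / ring_add A x y >-> x + y} &
      {morph f : x y / ring_mul A x y >-> x * y}].

Section DerivedEndomorphisms.
Variables (R : pzRingType) (X : bcomplex R).

Lemma Dadd0l : left_id (Dzero X X) (@Dadd R X X).
Proof. by move=> f; rewrite DaddC Dadd0. Qed.
Lemma DaddNl : left_inverse (Dzero X X) (@Dopp R X X) (@Dadd R X X).
Proof. by move=> f; rewrite DaddC DaddN. Qed.
Lemma Dcomp_assoc : associative (@Dcomp R X X X).
Proof. by move=> f g h; apply: DcompA. Qed.
Lemma Dcomp_id : left_id (Did X) (@Dcomp R X X X).
Proof. by move=> f; apply: Dcomp1l. Qed.
Lemma Dcomp_idr : right_id (Did X) (@Dcomp R X X X).
Proof. by move=> f; apply: Dcomp1r. Qed.
Lemma Dcomp_distl : left_distributive (@Dcomp R X X X) (@Dadd R X X).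
Proof. by move=> f g h; apply: DcompDl. Qed.
Lemma Dcomp_distr : right_distributive (@Dcomp R X X X) (@Dadd R X X).
Proof. by move=> f g h; apply: DcompDr. Qed.

(* The ring Hom_{D^b(R-mod)}(X, X), with composition as multiplication. *)
Definition Dendo : ring_on (Dhom X X) :=
  RingOn (@DaddA R X X) (@DaddC R X X) Dadd0l DaddNl
    Dcomp_assoc Dcomp_id Dcomp_idr Dcomp_distl Dcomp_distr.

Definition Dcoh_endo (n : int) (f : Dhom X X) : endo (cohomology X n) := Dcoh n f.

Lemma Dcoh_endo_ring_hom n : is_ring_hom Dendo (Dcoh_endo n).
Proof.
split=> [|f g|f g].
- exact: Dcoh_id.
- by apply: linear_ext => c; apply: Dcoh_add.
- exact: Dcoh_comp.
Qed.

End DerivedEndomorphisms.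

Section TwoTerm.
Variables (R U : pzRingType) (u : {rmorphism R -> U}).

Definition two_term_ob (n : int) : lmodType R :=
  match n with
  | Negz 0 => R^o
  | Posz 0 => lres u
  | _ => 'rV[R]_0
  end.

Definition two_term_d (i j : int) : {linear two_term_ob i -> two_term_ob j} :=
  match i, j return {linear two_term_ob i -> two_term_ob j} with
  | Negz 0, Posz 0 => lres_unit u
  | _, _ => \0
  end.

Lemma two_term_shape i j : j != i + 1 -> forall x, two_term_d i j x = 0.
Proof. by case: i j => [i|[|i]] [[|j]|j]. Qed.

Lemma two_term_dd i j k x : two_term_d j k (two_term_d i j x) = 0.
Proof. by case: i j k x => [i|[|i]] [[|j]|[|j]] [[|k]|k] x //=; rewrite ?linear0. Qed.

Lemma two_term_bounded :
  exists b : nat, forall i, (b < `|i|)%N -> forall x : two_term_ob i, x = 0.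
Proof. by exists 1%N => -[[|[|i]]|[|i]] // _ x; apply: thinmx0. Qed.

Definition two_term : bcomplex R :=
  BComplex two_term_shape two_term_dd two_term_bounded.

(* U/R is by definition H^0 of the complex; [UmodR_pi_surj] and [UmodR_piP]
   identify it with the cokernel of u. *)
Definition UmodR : lmodType R := cohomology two_term 0.

Lemma two_term_cocycle (x : lres u) : (x : two_term 0) \in is_cocycle two_term 0.
Proof. exact/eqP. Qed.

Definition UmodR_pi (x : lres u) : UmodR := coh_class (Cocycle (two_term_cocycle x)).

Lemma UmodR_pi_linear : linear UmodR_pi.
Proof.
move=> a x y; rewrite /UmodR_pi -coh_classZ -coh_classD.
by congr coh_class; apply: val_inj.
Qed.
HB.instance Definition _ := GRing.isLinear.Build R _ _ _ UmodR_pi UmodR_pi_linear.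

Lemma UmodR_pi_surj (c : UmodR) : exists x, UmodR_pi x = c.
Proof.
exists (val (repr c)); rewrite -[RHS]coh_reprK.
by congr coh_class; apply: val_inj.
Qed.

Lemma UmodR_piP (x : lres u) : UmodR_pi x = 0 <-> exists a : R, u a = x.
Proof.
rewrite -[0]coh_class0; split=> [/coh_classP[a da]|[a ua]].
  by exists a; rewrite -[RHS]subr0 -[RHS]da.
by apply/coh_classP; exists a; rewrite subr0 -[RHS]ua.
Qed.

End TwoTerm.

(* Main.v *)
Require Import Defs.
From HB Require Import structures.
From mathcomp Require Import all_boot all_algebra.
From mathcomp Require Import boolp.

Import GRing.Theory.
Local Open Scope ring_scope.

Set Implicit Arguments.
Unset Strict Implicit.
Unset Printing Implicit Defensive.

(** Write [x] for the class in U/R of an element x of U.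

Surjectivity.  Let P1 -> P0 -> U be a projective resolution of U of length one
and let p0 in P0 lie over 1.  The complex L = (P1 + R -> P0), with differential
(p, r) |-> d p + r p0, is quasi-isomorphic to K = (R -> U) through the
augmentation and the second projection ([quasi_iso_cone_res]).  It has
projective terms and lives in two degrees only, so an endomorphism g of
U/R = H^0(K) lifts to a chain map f : L -> K ([cone_lift_endo]): the composite
P0 -> U -> U/R -> U/R lifts to f0 : P0 -> U since P0 is projective, then f0
maps boundaries of L into u(R), and f0 d lifts along u to P1 + R.  Because L
vanishes in degree -2 there is no further condition on the lift; this is the
vanishing of Ext^2(U, ker u).  The roof K <- L -> K is the required morphism.

Commutativity.  For endomorphisms f and g of U/R and m, n in U, choose lifts b
of f[m] and c of g[n] to U, and put

  D(m, n) = [b c] - f[m c] - g[b n].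

As u(R) is central in U when R is commutative, changing b or c by an element
of u(R) does not change D(m, n) ([leibniz_pairingE]); so D is biadditive and
R-balanced, hence factors through the tensor product of U with itself over R.
There the tensors of (x, 1) and (1, x) agree because u is an epimorphism.
Finally D(x, 1) = - g(f[x]), with c = 0, and D(1, x) = - f(g[x]), with b = 0
([UmodR_endo_comm]). *)

(** * Balanced maps and ring epimorphisms *)

Section TensorElimination.
Variables (R : pzRingType) (M : lmodType R^c) (N : lmodType R) (A : zmodType).
Variable D : M -> N -> A.
Hypothesis D_addl : forall m m' n, D (m + m') n = D m n + D m' n.
Hypothesis D_addr : forall m n n', D m (n + n') = D m n + D m n'.
Hypothesis D_bal : forall (a : R) m n, D ((a : R^c) *: m) n = D m (a *: n).

Lemma tens_rel_sum s t : tens_rel s t ->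
  \sum_(p <- s) D p.1 p.2 = \sum_(p <- t) D p.1 p.2.
Proof.
elim=> {s t} //=.
- by move=> s t r _ -> _ ->.
- by move=> s s' t t' _ IH1 _ IH2; rewrite !big_cat /= IH1 IH2.
- by move=> s t; rewrite !big_cat /= addrC.
- move=> n; rewrite big_seq1 big_nil /=.
  by apply: (addrI (D 0 n)); rewrite -D_addl !addr0.
- by move=> m m' n; rewrite !big_cons big_nil !addr0 D_addl.
- by move=> m n n'; rewrite !big_cons big_nil !addr0 D_addr.
- by move=> a m n; rewrite !big_seq1 /= D_bal.
Qed.
End TensorElimination.

Section Epi.
Variables (R U : pzRingType) (u : {rmorphism R -> U}).
Hypothesis u_epi : ring_epimorphism u.

(** The multiplication sends both tensors of (x, 1) and (1, x) to x, and it is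
injective, so no balanced biadditive map can tell them apart. *)
Lemma epi_balanced_swap (A : zmodType) (D : U -> U -> A) :
  (forall m m' n, D (m + m') n = D m n + D m' n) ->
  (forall m n n', D m (n + n') = D m n + D m n') ->
  (forall a m n, D (m * u a) n = D m (u a * n)) ->
  forall x, D x 1 = D 1 x.
Proof.
move=> Dl Dr Db x.
have : tens_pi [:: (x : rres u, 1 : lres u)] = tens_pi [:: (1 : rres u, x : lres u)].
  by apply: (bij_inj u_epi); rewrite !tens_multE !big_seq1 /= mulr1 mul1r.
move=> /tens_piP /(@tens_rel_sum _ (rres u) (lres u) A D Dl Dr Db).
by rewrite !big_seq1.
Qed.

(** When R is commutative, (m, n) |-> m u(r) n is balanced; it takes the values
x u(r) at (x, 1) and u(r) x at (1, x). *)
Lemma epi_comm_central : (forall a b : R, a * b = b * a) ->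
  forall r x, u r * x = x * u r.
Proof.
move=> commR r x.
have := @epi_balanced_swap U (fun m n => m * u r * n).
move=> /(_ _ _ _ x); rewrite !mulr1 !mul1r => <- //.
- by move=> m m' n; rewrite !mulrDl.
- by move=> m n n'; rewrite mulrDr.
- by move=> a m n; rewrite -!mulrA [u a * _]mulrA [u r * (_ * _)]mulrA -!rmorphM commR.
Qed.

End Epi.

(** * Commutativity of the endomorphism ring of U/R *)

Section CommutingEndomorphisms.
Variables (R U : pzRingType) (u : {rmorphism R -> U}).
Hypothesis u_epi : ring_epimorphism u.
Hypothesis u_central : forall r x, u r * x = x * u r.
Variables f g : {linear UmodR u -> UmodR u}.

Local Notation pi := (@UmodR_pi R U u).

Lemma UmodR_piZl r (x : U) : pi (u r * x) = r *: pi x.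
Proof. by rewrite -[u r * x]/(r *: (x : lres u)) linearZ. Qed.

Lemma UmodR_piZr r (x : U) : pi (x * u r) = r *: pi x.
Proof. by rewrite -u_central UmodR_piZl. Qed.

Lemma UmodR_piD (x y : U) : pi (x + y) = pi x + pi y.
Proof. exact: (linearD (pi : {linear lres u -> UmodR u})). Qed.

Lemma UmodR_pi_eq (x y : U) : pi x = pi y -> exists r, x = y + u r.
Proof.
move=> exy; have [|r ur] := (UmodR_piP (x - y : lres u)).1.
  by rewrite (linearB (pi : {linear lres u -> UmodR u})) /= exy subrr.
by exists r; rewrite [u r]ur addrC subrK.
Qed.

(** Here b and c stand for lifts to U of f [m] and g [n].  The two correction
terms are chosen so that the expression does not depend on these lifts. *)
Definition leibniz_defect (m n b c : U) : UmodR u :=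
  pi (b * c) - f (pi (m * c)) - g (pi (b * n)).

(** Adding u r to b adds r [c] to the first term and g (r [n]) to the last; these
cancel since [c] = g [n].  The first and second terms cancel in the same way
when c varies. *)
Lemma leibniz_defect_eql m n b b' c : pi b = pi b' -> pi c = g (pi n) ->
  leibniz_defect m n b c = leibniz_defect m n b' c.
Proof.
move=> /UmodR_pi_eq[r ->] gc; rewrite /leibniz_defect !mulrDl !UmodR_piD.
rewrite !UmodR_piZl linearD linearZ /= gc opprD.
by rewrite [X in X + _]addrAC addrACA subrr addr0.
Qed.

Lemma leibniz_defect_eqr m n b c c' : pi b = f (pi m) -> pi c = pi c' ->
  leibniz_defect m n b c = leibniz_defect m n b c'.
Proof.
move=> fb /UmodR_pi_eq[r ->]; rewrite /leibniz_defect !mulrDr !UmodR_piD.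
by rewrite !UmodR_piZr linearD linearZ /= fb opprD addrACA subrr addr0.
Qed.

Definition UmodR_lift (y : UmodR u) : U := sval (cid (UmodR_pi_surj y)).

Lemma UmodR_liftK y : pi (UmodR_lift y) = y.
Proof. by rewrite /UmodR_lift; case: cid. Qed.

Definition leibniz_pairing (m n : U) : UmodR u :=
  leibniz_defect m n (UmodR_lift (f (pi m))) (UmodR_lift (g (pi n))).

(** Independence of the lifts, which makes additivity and balancedness below a
matter of choosing convenient ones. *)
Lemma leibniz_pairingE m n b c : pi b = f (pi m) -> pi c = g (pi n) ->
  leibniz_pairing m n = leibniz_defect m n b c.
Proof.
move=> fb gc; rewrite /leibniz_pairing.
rewrite (@leibniz_defect_eql _ _ _ b) ?UmodR_liftK //.
by rewrite (@leibniz_defect_eqr _ _ _ _ c) ?UmodR_liftK.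
Qed.

Lemma leibniz_pairingDl m m' n :
  leibniz_pairing (m + m') n = leibniz_pairing m n + leibniz_pairing m' n.
Proof.
rewrite (@leibniz_pairingE (m + m') n
  (UmodR_lift (f (pi m)) + UmodR_lift (f (pi m'))) (UmodR_lift (g (pi n)))).
- rewrite /leibniz_pairing /leibniz_defect !mulrDl !UmodR_piD !linearD /=.
  by rewrite [X in X + _ = _]addrACA [LHS]addrACA.
- by rewrite !UmodR_piD !UmodR_liftK linearD.
- by rewrite UmodR_liftK.
Qed.

Lemma leibniz_pairingDr m n n' :
  leibniz_pairing m (n + n') = leibniz_pairing m n + leibniz_pairing m n'.
Proof.
rewrite (@leibniz_pairingE m (n + n')
  (UmodR_lift (f (pi m))) (UmodR_lift (g (pi n)) + UmodR_lift (g (pi n')))).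
- rewrite /leibniz_pairing /leibniz_defect !mulrDr !UmodR_piD !linearD /=.
  by rewrite [X in X + _ = _]addrACA [LHS]addrACA.
- by rewrite UmodR_liftK.
- by rewrite !UmodR_piD !UmodR_liftK linearD.
Qed.

Lemma leibniz_pairing_balanced r m n :
  leibniz_pairing (m * u r) n = leibniz_pairing m (u r * n).
Proof.
rewrite (@leibniz_pairingE (m * u r) n
  (UmodR_lift (f (pi m)) * u r) (UmodR_lift (g (pi n)))).
- rewrite (@leibniz_pairingE m (u r * n)
    (UmodR_lift (f (pi m))) (u r * UmodR_lift (g (pi n)))).
  + by rewrite /leibniz_defect !mulrA.
  + by rewrite UmodR_liftK.
  + by rewrite !UmodR_piZl UmodR_liftK linearZ.
- by rewrite !UmodR_piZr UmodR_liftK linearZ.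
- by rewrite UmodR_liftK.
Qed.

Lemma UmodR_pi1 : pi (1 : U) = 0.
Proof. by apply/UmodR_piP; exists 1; rewrite rmorph1. Qed.

Lemma UmodR_endo_comm y : f (g y) = g (f y).
Proof.
have [x <-] := UmodR_pi_surj y.
have := epi_balanced_swap u_epi leibniz_pairingDl leibniz_pairingDr
  leibniz_pairing_balanced x.
(* [1] = 0 in U/R, so 0 lifts both f [1] and g [1]. *)
have f1 : pi (0 : U) = f (pi 1) by rewrite UmodR_pi1 !linear0.
have g1 : pi (0 : U) = g (pi 1) by rewrite UmodR_pi1 !linear0.
rewrite (leibniz_pairingE (UmodR_liftK (f (pi x))) g1).
rewrite (leibniz_pairingE f1 (UmodR_liftK (g (pi x)))).
rewrite /leibniz_defect !(mulr0, mul0r, mulr1, mul1r) !UmodR_liftK !linear0.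
by rewrite !(addr0, add0r) => /oppr_inj.
Qed.

End CommutingEndomorphisms.

(** * Lifting against a map that is onto the relevant image *)

Section ProjectiveLifting.
Variable R : pzRingType.

Section Image.
Variables (A B : lmodType R) (h : {linear A -> B}).

Definition in_lin_image : {pred B} := fun b => `[< exists a, h a = b >].

Lemma in_lin_image_closed : submod_closed in_lin_image.
Proof.
split=> [|k x y]; first by apply/asboolP; exists 0; rewrite linear0.
move=> /asboolP[a <-] /asboolP[b <-]; apply/asboolP.
by exists (k *: a + b); rewrite linearP.
Qed.
HB.instance Definition _ := GRing.isSubmodClosed.Build R B in_lin_image
  in_lin_image_closed.

Record lin_image := LinImage { lin_image_val : B; _ : lin_image_val \in in_lin_image }.
HB.instance Definition _ := [isSub for lin_image_val].
HB.instance Definition _ := [Choice of lin_image by <:].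
HB.instance Definition _ := [SubChoice_isSubLmodule of lin_image by <:].

End Image.

Section Corestriction.
Variables (A B P : lmodType R) (h : {linear A -> B}) (f : {linear P -> B}).
Hypothesis f_im : forall x, f x \in in_lin_image h.

Definition corestrict (x : P) : lin_image h := LinImage (f_im x).
Lemma corestrict_linear : linear corestrict.
Proof. by move=> a x y; apply: val_inj; rewrite /= linearP. Qed.
HB.instance Definition _ :=
  GRing.isLinear.Build R P (lin_image h) _ corestrict corestrict_linear.

End Corestriction.

(** Projectivity is applied to the corestriction of h to its image. *)
Lemma projective_lift_image (P A B : lmodType R) (h : {linear A -> B})
    (f : {linear P -> B}) : projective P -> (forall x, exists a, h a = f x) ->
  exists k : {linear P -> A}, forall x, h (k x) = f x.
Proof.
move=> projP f_im.
have h_im a : h a \in in_lin_image h by apply/asboolP; exists a.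
have f_im' x : f x \in in_lin_image h by apply/asboolP/f_im.
have [|k hk] := projP _ _ (corestrict h_im) (corestrict f_im').
  case=> b bP; have /asboolP[a ha] := bP.
  by exists a; apply: val_inj.
by exists k => x; have /(congr1 val) := hk x.
Qed.

End ProjectiveLifting.

(** * Two-term projective model of the complex K *)

Section ConeResolution.
Variables (R U : pzRingType) (u : {rmorphism R -> U}).
Variables (P1 P0 : lmodType R) (d : {linear P1 -> P0}) (aug : {linear P0 -> lres u}).
Hypothesis aug_surj : forall y, exists x, aug x = y.
Hypothesis aug_exact : forall x, aug x = 0 <-> exists y, d y = x.
Hypothesis d_inj : forall x, d x = 0 -> x = 0.
Variable p0 : P0.
Hypothesis aug_p0 : aug p0 = 1 :> U.

(** The degree -1 differential of the cone of the map from R to the complex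
P1 -> P0 which lifts u by sending 1 to p0. *)
Definition cone_diff (x : P1 * R^o) : P0 := d x.1 + (x.2 : R) *: p0.

Lemma cone_diff_linear : linear cone_diff.
Proof.
move=> a x y; rewrite /cone_diff /= linearP scalerDl scalerDr scalerA.
by rewrite addrACA.
Qed.
HB.instance Definition _ := GRing.isLinear.Build R (P1 * R^o)%type P0 _
  cone_diff cone_diff_linear.

Lemma aug_scale_p0 r : aug (r *: p0) = u r :> U.
Proof. by rewrite linearZ /= aug_p0; apply: mulr1. Qed.

Lemma aug_cone_diff x : aug (cone_diff x) = u x.2 :> U.
Proof.
rewrite /cone_diff linearD [aug (d _)](aug_exact _).2 ?add0r ?aug_scale_p0 //.
by exists x.1.
Qed.

Definition cone_ob (n : int) : lmodType R :=
  match n with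
  | Negz 0 => (P1 * R^o)%type
  | Posz 0 => P0
  | _ => 'rV[R]_0
  end.

Definition cone_d (i j : int) : {linear cone_ob i -> cone_ob j} :=
  match i, j return {linear cone_ob i -> cone_ob j} with
  | Negz 0, Posz 0 => cone_diff
  | _, _ => \0
  end.

Lemma cone_shape i j : j != i + 1 -> forall x, cone_d i j x = 0.
Proof. by case: i j => [i|[|i]] [[|j]|j]. Qed.

Lemma cone_dd i j k x : cone_d j k (cone_d i j x) = 0.
Proof. by case: i j k x => [i|[|i]] [[|j]|[|j]] [[|k]|k] x //=; rewrite ?linear0. Qed.

Lemma cone_bounded :
  exists b : nat, forall i, (b < `|i|)%N -> forall x : cone_ob i, x = 0.
Proof. by exists 1%N => -[[|[|i]]|[|i]] // _ x; apply: thinmx0. Qed.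

Definition cone : bcomplex R := BComplex cone_shape cone_dd cone_bounded.

Section ToTwoTerm.
Variables (f1 : {linear (P1 * R^o)%type -> R^o}) (f0 : {linear P0 -> lres u}).
Hypothesis f_comm : forall x, f0 (cone_diff x) = u (f1 x) :> U.

Definition cone_map_at (n : int) : {linear cone n -> two_term u n} :=
  match n return {linear cone n -> two_term u n} with
  | Negz 0 => f1
  | Posz 0 => f0
  | _ => \0
  end.

Lemma cone_map_comm i j x :
  cone_map_at j (cx_d cone i j x) = cx_d (two_term u) i j (cone_map_at i x).
Proof.
by case: i j x => [[|i]|[|i]] [[|j]|[|j]] x //=; rewrite ?linear0 //; apply: f_comm.
Qed.

Definition cone_map : chmap cone (two_term u) := ChMap cone_map_comm.

End ToTwoTerm.

Definition cone_snd (x : P1 * R^o) : R^o := x.2.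
Lemma cone_snd_linear : linear cone_snd. Proof. by []. Qed.
HB.instance Definition _ := GRing.isLinear.Build R (P1 * R^o)%type R^o _
  cone_snd cone_snd_linear.

Definition cone_res : chmap cone (two_term u) :=
  @cone_map cone_snd aug aug_cone_diff.

(** In degree 0 both cokernels are U/R.  In degree -1 a pair (p, r) is a cocycle
iff d p = - r p0, so u r = 0, and r determines p because d is injective. *)
Lemma quasi_iso_cone_res : quasi_iso cone_res.
Proof.
apply/quasi_isoP => -[[|n]|[|n]].
- split=> [x _ [r /= ur]|y _].
    have [|p dp] := (aug_exact (x - (r : R) *: p0)).1.
      rewrite linearB [aug x](esym ur).
      by apply/eqP; rewrite subr_eq0 [aug _]aug_scale_p0.
    by exists (p, r); rewrite /= /cone_diff dp subrK.
  have [x <-] := aug_surj y.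
  by exists x, 0; split=> //; rewrite linear0 addr0.
- split=> [x _ _|y _]; first by exists 0; rewrite linear0; apply/esym/thinmx0.
  by exists 0, 0; rewrite !linear0 addr0; split=> //; apply: thinmx0.
- split=> [[p r] /= dpr [y ry]|r /= ur].
    have r0 : r = 0 by rewrite -ry.
    have p0' : p = 0.
      by apply: d_inj; move: dpr; rewrite /cone_diff r0 scale0r addr0.
    by exists 0; rewrite p0' r0.
  have [|p dp] := (aug_exact ((r : R) *: p0)).1.
    by rewrite [aug _]aug_scale_p0.
  exists (- p, r), 0; split; last by rewrite addr0.
  by rewrite /cone_diff /= linearN dp addNr.
- split=> [x _ _|y _]; first by exists 0; rewrite linear0; apply/esym/thinmx0.
  by exists 0, 0; rewrite !linear0 addr0; split=> //; apply: thinmx0.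
Qed.

Hypotheses (proj_P0 : projective P0) (proj_P1 : projective P1).

(** The degree 0 component lifts g to P0.  It sends boundaries into u(R), because
g kills their class; this gives the degree -1 component, from projectivity on
P1 and by the choice of one value on R. *)
Lemma cone_lift_endo (g : {linear UmodR u -> UmodR u}) :
  exists f : chmap cone (two_term u),
    forall x : P0, UmodR_pi (f 0 x) = g (UmodR_pi (aug x)).
Proof.
have [f0 f0P] := proj_P0 (g \o (@UmodR_pi R U u) \o aug) (@UmodR_pi_surj R U u).
have f0_im (x : P1 * R^o) : exists r : R, u r = f0 (cone_diff x).
  apply/UmodR_piP; rewrite f0P /= (_ : UmodR_pi _ = 0) ?linear0 //.
  by apply/UmodR_piP; exists x.2; rewrite [aug _]aug_cone_diff.
have [|k kP] := @projective_lift_image R P1 R^o (lres u) (lres_unit u)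
  (f0 \o d) proj_P1.
  by move=> p; have [r ur] := f0_im (p, 0); exists r;
     rewrite [LHS]ur /cone_diff scale0r addr0.
(* c is the value of the degree -1 component at (0, 1). *)
have [c cP] := f0_im (0, 1).
rewrite /cone_diff linear0 add0r scale1r in cP.
pose f1fun (x : P1 * R^o) : R^o := k x.1 + (x.2 : R) *: (c : R^o).
have f1lin : linear f1fun.
  move=> a x y; rewrite /f1fun /= linearP scalerDl scalerDr scalerA.
  by rewrite addrACA.
pose f1 : {linear (P1 * R^o)%type -> R^o} :=
  HB.pack f1fun (GRing.isLinear.Build R (P1 * R^o)%type R^o _ f1fun f1lin).
have f_comm x : f0 (cone_diff x) = u (f1 x) :> U.
  rewrite /cone_diff linearD linearZ /= /f1fun rmorphD rmorphM cP.
  by rewrite -[f0 (d _)]kP.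
by exists (cone_map f_comm).
Qed.

Lemma Dcoh0_two_term_surj (g : {linear UmodR u -> UmodR u}) :
  exists f : Dhom (two_term u) (two_term u), forall c, Dcoh 0 f c = g c.
Proof.
have [f fP] := cone_lift_endo g.
exists (Dcomp (Dmap f) (Dinv quasi_iso_cone_res)) => c.
rewrite Dcoh_comp Dcoh_map [Dcoh 0 (Dinv _)]Dcoh_class /=.
set s := lin_inv _ c.
have <- : coh_map 0 cone_res s = c by apply: lin_invK.
rewrite -[s]coh_reprK /= !coh_map_class; case: (repr s) => x xP.
transitivity (UmodR_pi (f 0 x)); first by congr coh_class; apply: val_inj.
by rewrite fP; congr (g _); congr coh_class; apply: val_inj.
Qed.

End ConeResolution.

(** * The degree zero cohomology homomorphism of K *)

Theorem lemma4p2 (R U : pzRingType) (u : {rmorphism R -> U})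
    (u_epi : ring_epimorphism u)
    (Tor1_UU : Tor_vanishes (rres u) (lres u) 1)
    (pd_U : proj_dim_le (lres u) 1) :
  [/\ is_ring_hom (Dendo (two_term u))
        (Dcoh_endo 0 : Dhom (two_term u) (two_term u) -> endo (UmodR u)),
      forall g : endo (UmodR u),
        exists f : Dhom (two_term u) (two_term u), Dcoh_endo 0 f = g &
      (forall a b : R, a * b = b * a) ->
      forall f g : endo (UmodR u), f * g = g * f].
Proof.
split.
- exact: Dcoh_endo_ring_hom.
- move=> g; have [P P_gt1] := pd_U.
  have [p0 aug_p0] := res_aug_surj P (1 : U).
  (* P vanishes in degree 2, so exactness in degree 1 is injectivity. *)
  have d_inj x : res_d P 0 x = 0 -> x = 0.
    by move=> /res_exactS[y <-]; rewrite (P_gt1 2%N erefl y) linear0.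
  have [f fg] := Dcoh0_two_term_surj (@res_aug_surj _ _ P) (@res_exact0 _ _ P)
    d_inj aug_p0 (@res_proj _ _ P 0) (@res_proj _ _ P 1) g.
  by exists f; apply: linear_ext.
- move=> commR f g; apply: linear_ext => y.
  exact: (UmodR_endo_comm u_epi (epi_comm_central u_epi commR) f g).
Qed.
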